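(* Let $X\subset\mathbb{P}^d$ be a real subvariety of pure dimension $k$ that admits a very reasonable Hermitian Livsic-type determinantal representation $\gamma\in\wedge^{k+1}\mathbb{C}^{d+1}\otimes M_n(\mathbb{C})$ (so $X=D(\gamma)$). Assume that for some real $(d-k-1)$-dimensional linear subspace $V\subset\mathbb{P}^d$ the matrix $\gamma(V)$ is positive definite. Then $X$ is hyperbolic with respect to $V$.
   Context: **Tensors.** For $\gamma\in\wedge^{k+1}\mathbb{C}^{d+1}\otimes M_n(\mathbb{C})$ put $D(\gamma)=\{\mu\in\mathbb{P}^d:\exists\,w\in\mathbb{C}^n\setminus\{0\},\ (\gamma\wedge\mu)w=0\}$, where $\gamma\wedge\mu$ is viewed as a map $\mathbb{C}^n\to\wedge^{k+2}\mathbb{C}^{d+1}\otimes\mathbb{C}^n$. For a linear subspace $V\subset\mathbb{P}^d$ of (projective) dimension $d-k-1$ spanned by $v_0,\dots,v_{d-k-1}$ put $\gamma(V)=\gamma\wedge v_0\wedge\dots\wedge v_{d-k-1}$, viewed as a matrix in $M_n(\mathbb{C})$ via a fixed orientation $\wedge^{d+1}\mathbb{C}^{d+1}\cong\mathbb{C}$ (sending $e_0\wedge\cdots\wedge e_d$ to $1$ for a real basis $e_0,\dots,e_d$); for real $V$ a real basis $v_0,\dots,v_{d-k-1}$ is used. $\gamma$ is non-degenerate if $\gamma(V)$ is invertible for some $V$ (then $\dim D(\gamma)\le k$). For non-degenerate $\gamma$, $\deg\gamma=\sum_j n_j\deg D_j$, summed over the $k$-dimensional irreducible components $D_j$ of $D(\gamma)$,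 where $n_j$ is the dimension of $\ker(\gamma\wedge\mu)$ for generic $\mu\in D_j$. $\gamma$ is very reasonable if it is non-degenerate and $\deg\gamma=n$. $\gamma=\sum_I\gamma_Ie_I$ is Hermitian if every coefficient $\gamma_I$ with respect to a real basis is a Hermitian matrix. **Hyperbolicity.** A real subvariety $X\subset\mathbb{P}^d$ of pure codimension $\ell=d-k$ is hyperbolic with respect to a real $(\ell-1)$-dimensional linear subspace $V$ if $V\cap X=\emptyset$ and for every real $\ell$-dimensional linear subspace $U\supset V$ one has $X\cap U\subset X(\mathbb{R})$. *)

(* Defs.v *)
From HB Require Import structures.
From mathcomp Require Import all_boot all_order all_algebra.
From mathcomp Require Import mathcomp_extra boolp classical_sets functions.
From mathcomp Require Import cardinality reals.
From mathcomp Require Import complex.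
From mathcomp Require Import mpoly.

Set Implicit Arguments.
Unset Strict Implicit.
Unset Printing Implicit Defensive.

Import Order.TTheory GRing.Theory Num.Theory.

Local Open Scope ring_scope.
Local Open Scope complex_scope.
Local Open Scope sesquilinear_scope.
Local Open Scope classical_set_scope.

Section ProjectiveSpace.
Variables (R : realType) (d : nat).
Local Notation C := R[i].
Local Notation vec := 'rV[C]_d.+1.

(* A point of P^d is a line of C^(d+1).  A linear subspace of P^d of projective
   dimension m is a W : {vspace vec} with \dim W = m.+1 (the empty subspace, of
   dimension -1, is 0%VS); the point x lies on it when (val x <= W)%VS. *)
Definition proj_space : Type := {L : {vspace vec} | \dim L == 1%N}.

(* Homogeneous coordinates: a nonzero vector on the line. *)
Definition hcoord (x : proj_space) : vec := vpick (val x).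

Definition real_vec (v : vec) : Prop := forall i, v 0 i \is Num.real.

Definition real_subspace (W : {vspace vec}) : Prop :=
  exists2 b : seq vec, basis_of W b & forall v, v \in b -> real_vec v.

Definition real_point (x : proj_space) : Prop := real_subspace (val x).

Definition vanishes_at (f : {mpoly C[d.+1]}) (x : proj_space) : Prop :=
  f.@[fun i => hcoord x 0 i] = 0.

Definition zero_locus (S : set {mpoly C[d.+1]}) : set proj_space :=
  [set x | forall f, S f -> vanishes_at f x].

Definition homogeneous_poly (f : {mpoly C[d.+1]}) : Prop :=
  exists m : nat, f \is m.-homog.

Definition zariski_closed (X : set proj_space) : Prop :=
  exists2 S : set {mpoly C[d.+1]},
    (forall f, S f -> homogeneous_poly f) & X = zero_locus S.

Definition real_subvariety (X : set proj_space) : Prop :=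
  exists2 S : set {mpoly C[d.+1]},
    (forall f, S f ->
       homogeneous_poly f /\ forall m : 'X_{1..d.+1}, f@_m \is Num.real)
    & X = zero_locus S.

Definition irreducible_closed (Z : set proj_space) : Prop :=
  [/\ zariski_closed Z, Z !=set0 &
      forall A B, zariski_closed A -> zariski_closed B ->
        Z `<=` A `|` B -> Z `<=` A \/ Z `<=` B].

Definition irreducible_component (X Z : set proj_space) : Prop :=
  [/\ irreducible_closed Z, Z `<=` X &
      forall Y, irreducible_closed Y -> Z `<=` Y -> Y `<=` X -> Y = Z].

Definition has_chain (Z : set proj_space) (m : nat) : Prop :=
  exists2 c : nat -> set proj_space,
    (forall i, (i <= m)%N -> irreducible_closed (c i) /\ c i `<=` Z)
    & (forall i, (i < m)%N -> c i `<` c i.+1).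

(* Krull dimension of the Zariski topology *)
Definition has_dimension (Z : set proj_space) (m : nat) : Prop :=
  has_chain Z m /\ ~ has_chain Z m.+1.

Definition pure_dimension (X : set proj_space) (m : nat) : Prop :=
  forall Z, irreducible_component X Z -> has_dimension Z m.

(* Z, of dimension m, has degree e: a generic linear subspace of codimension m,
   given by the m linear equations A *m x^T = 0, meets Z in exactly e points.
   "Generic" means off the zero set of a nonzero polynomial P in the entries
   of A. *)
Definition has_degree (Z : set proj_space) (m e : nat) : Prop :=
  exists2 P : {mpoly C[m * d.+1]}, P != 0 &
    forall A : 'M[C]_(m, d.+1), P.@[fun i => mxvec A 0 i] != 0 ->
      ([set x | Z x /\ A *m (hcoord x)^T = 0] #= `I_e)%card.

(* Q holds on a nonempty Zariski open subset of Z. *)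
Definition generically (Z : set proj_space) (Q : proj_space -> Prop) : Prop :=
  exists2 W, zariski_closed W &
    ~ (Z `<=` W) /\ forall x, Z x -> ~ W x -> Q x.

Definition hyperbolic (X : set proj_space) (V : {vspace vec}) : Prop :=
  (forall x, X x -> ~ (val x <= V)%VS) /\
  (forall U : {vspace vec}, real_subspace U -> \dim U = (\dim V).+1 ->
     (V <= U)%VS -> forall x, X x -> (val x <= U)%VS -> real_point x).

End ProjectiveSpace.

Section Tensors.
Variables (R : realType) (d n : nat).
Local Notation C := R[i].
Local Notation vec := 'rV[C]_d.+1.

(* The full exterior algebra of C^(d+1) tensored with M_n(C); g I is the
   coefficient of e_I = e_(i_1) /\ ... /\ e_(i_p), for I = {i_1 < ... < i_p}
   and the standard basis e_0, ..., e_d. *)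
Definition tensor : Type := {ffun {set 'I_d.+1} -> 'M[C]_n}.

(* g belongs to the p-th exterior power tensored with M_n(C). *)
Definition tensor_of_degree (p : nat) (g : tensor) : Prop :=
  forall I : {set 'I_d.+1}, #|I| != p -> g I = 0.

(* The product g /\ v.  The sign comes from
   e_(J \ j) /\ e_j = (-1)^#{i in J | j < i} e_J. *)
Definition wedge (g : tensor) (v : vec) : tensor :=
  [ffun J : {set 'I_d.+1} =>
    \sum_(j in J)
      ((-1) ^+ #|[set i in J | (j < i)%N]| * v 0 j) *: g (J :\ j)%SET].

(* g viewed as a linear map from C^n to (exterior algebra) (x) C^n *)
Definition tensor_map (g : tensor) (w : 'cV[C]_n) :
    {ffun {set 'I_d.+1} -> 'cV[C]_n} :=
  [ffun J : {set 'I_d.+1} => g J *m w].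

Lemma tensor_map_is_linear (g : tensor) : linear (tensor_map g).
Proof.
by move=> a u v; apply/ffunP => J; rewrite !ffunE mulmxDr -scalemxAr.
Qed.

HB.instance Definition _ (g : tensor) :=
  GRing.isLinear.Build C 'cV[C]_n {ffun {set 'I_d.+1} -> 'cV[C]_n} _
    (tensor_map g) (tensor_map_is_linear g).

Definition tensor_ker (g : tensor) : {vspace 'cV[C]_n} :=
  lker (linfun (tensor_map g)).

Definition D (g : tensor) : set (proj_space R d) :=
  [set x | exists2 w : 'cV[C]_n, w != 0 & tensor_map (wedge g (hcoord x)) w = 0].

(* g(V) for V spanned by s = (v_0, ..., v_r): the coefficient of
   e_0 /\ ... /\ e_d in g /\ v_0 /\ ... /\ v_r *)
Definition tensor_at (g : tensor) (s : seq vec) : 'M[C]_n :=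
  foldl wedge g s [set: 'I_d.+1]%SET.

Definition nondegenerate (k : nat) (g : tensor) : Prop :=
  exists2 v : (d - k).-tuple vec, free v & tensor_at g v \in unitmx.

(* deg g = m: Z lists the k-dimensional irreducible components of D(g) without
   repetition, and the j-th one has degree e j and generic multiplicity mu j. *)
Definition tensor_degree (k : nat) (g : tensor) (m : nat) : Prop :=
  exists (r : nat) (Z : 'I_r -> set (proj_space R d)) (mu e : 'I_r -> nat),
    [/\ injective Z,
        (forall Y, (exists j, Z j = Y) <->
           irreducible_component (D g) Y /\ has_dimension Y k),
        (forall j, generically (Z j)
           (fun x => \dim (tensor_ker (wedge g (hcoord x))) = mu j)),
        (forall j, has_degree (Z j) k (e j))
      & m = (\sum_(j < r) mu j * e j)%N].

Definition very_reasonable (k : nat) (g : tensor) : Prop :=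
  nondegenerate k g /\ tensor_degree k g n.

Definition hermitian_tensor (g : tensor) : Prop :=
  forall I : {set 'I_d.+1}, g I \is hermsymmx.

Definition positive_definite (A : 'M[C]_n) : Prop :=
  A \is hermsymmx /\
  forall w : 'cV[C]_n, w != 0 -> 0 < (w^t* *m A *m w) 0 0.

End Tensors.

(* Main.v *)
From HB Require Import structures.
Require Import Defs.
From mathcomp Require Import all_boot all_order all_algebra.
From mathcomp Require Import classical_sets reals complex.

Set Implicit Arguments.
Unset Strict Implicit.
Unset Printing Implicit Defensive.

Import Order.TTheory GRing.Theory Num.Theory.

Local Open Scope ring_scope.
Local Open Scope complex_scope.
Local Open Scope sesquilinear_scope.

(** Let mu be a point of D(gamma) in the span of V and one real vector u, so
    that gamma /\ mu kills some nonzero w.  Write mu = a u + sum_i c_i v_i on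
    the given real basis v of V.  Whatever gamma /\ mu is multiplied by, w is
    still killed.  Multiplying by all the v_i except v_j leaves, by the
    alternating rule ([wedge_anticomm]),
<<
      c_j gamma(V) w = - a (-1)^j A_j w,
      A_j = gamma /\ u /\ v_0 /\ ... (v_j omitted) ...
>>
    ([kernel_coordinate]).  The matrix A_j is Hermitian since gamma is Hermitian
    and all the vectors are real, and gamma(V) is positive definite; pairing
    with the conjugate transpose of w therefore gives c_j = a q_j with q_j real
    ([kernel_coordinate_real]).  If a = 0 then every c_j vanishes and mu = 0,
    which is absurd: no point of D(gamma) lies on V.  If a is nonzero then mu is
    a multiple of the real vector u + sum_j q_j v_j, hence a real point
    ([D_real_span]).  Every real U of dimension one more than V is spanned by V
    and such a real u ([real_subspace_ext]). *)

(** * Linearity of the wedge product *)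

Section Wedge.
Variables (R : realType) (d n : nat).
Local Notation C := R[i].
Local Notation vec := 'rV[C]_d.+1.
Local Notation wedges := (foldl (@wedge R d n)).
Implicit Types (g h : tensor R d n) (u v z : vec) (s : seq vec).
Implicit Types (J : {set 'I_d.+1}) (w : 'cV[C]_n).

Lemma wedge_linear_left v a g h :
  wedge (a *: g + h) v = a *: wedge g v + wedge h v.
Proof.
apply/ffunP => J; rewrite !ffunE scaler_sumr -big_split /=.
by apply: eq_bigr => j _; rewrite !ffunE scalerDr !scalerA (mulrC _ a).
Qed.

Lemma wedge_is_linear g : linear (wedge g : vec -> tensor R d n).
Proof.
move=> a u v; apply/ffunP => J; rewrite !ffunE scaler_sumr -big_split /=.
apply: eq_bigr => j _.
by rewrite !mxE mulrDr scalerDl scalerA mulrCA.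
Qed.

Lemma wedge_seq_linear s a g h :
  wedges (a *: g + h) s = a *: wedges g s + wedges h s.
Proof. by elim: s g h => //= v s IHs g h; rewrite wedge_linear_left IHs. Qed.

Lemma wedge_seq0 s : wedges 0 s = 0.
Proof.
have := wedge_seq_linear s (-1) 0 0.
by rewrite scaler0 addr0 scaleN1r addNr.
Qed.

Lemma wedge_seqZ s a g : wedges (a *: g) s = a *: wedges g s.
Proof. by have := wedge_seq_linear s a g 0; rewrite wedge_seq0 !addr0. Qed.

(** * The alternating rule *)

(** Take i < j.  Removing i leaves the number of elements above j unchanged,
    while removing j lowers the number of elements above i by one: this single
    unit is the sign that makes the wedge product alternating. *)
Lemma wedge_sign_swap J (i j : 'I_d.+1) : i \in J -> j \in J -> i != j ->
  (-1) ^+ #|[set k in J | (j < k)%N]| *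
    (-1) ^+ #|[set k in (J :\ j)%SET | (i < k)%N]| =
  - ((-1) ^+ #|[set k in J | (i < k)%N]| *
      (-1) ^+ #|[set k in (J :\ i)%SET | (j < k)%N]|) :> C.
Proof.
wlog lt_ij : i j / (i < j)%N.
  move=> H Ji Jj ij; have [lt_ij|lt_ji|/val_inj e] := ltngtP i j.
  - exact: H.
  - by rewrite (H j i) ?opprK // eq_sym.
  - by rewrite e eqxx in ij.
move=> Ji Jj ij.
rewrite (cardsD1 j [set k in J | (i < k)%N]) inE Jj lt_ij /= exprS.
have -> : [set k in (J :\ i)%SET | (j < k)%N] = [set k in J | (j < k)%N].
  apply/setP => k; rewrite !inE; case: (k =P i) => [->|] //=.
  by rewrite ltnNge (ltnW lt_ij) andbF.
have -> : ([set k in J | (i < k)%N] :\ j)%SET =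
          [set k in (J :\ j)%SET | (i < k)%N].
  by apply/setP => k; rewrite !inE andbA.
by rewrite mulN1r mulNr opprK mulrC.
Qed.

(** Both sides expand over ordered pairs of distinct indices of J; exchanging
    the two sums matches the terms up to the sign of [wedge_sign_swap]. *)
Lemma wedge_anticomm g u v : wedge (wedge g u) v = - wedge (wedge g v) u.
Proof.
have expand x y J : wedge (wedge g x) y J =
    \sum_(j in J) \sum_(i in J | i != j)
      ((-1) ^+ #|[set k in J | (j < k)%N]| *
       (-1) ^+ #|[set k in (J :\ j)%SET | (i < k)%N]| * (y 0 j * x 0 i)) *:
        g (J :\ j :\ i)%SET.
  rewrite ffunE; apply: eq_bigr => j Jj; rewrite ffunE scaler_sumr.
  apply: eq_big => [i|i _]; first by rewrite !inE andbC.
  by rewrite scalerA mulrACA.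
apply/ffunP => J; rewrite [RHS]ffunE !expand -sumrN.
rewrite (exchange_big_dep (mem J)) /=; last by move=> ? ? _ /andP[].
apply: eq_bigr => i Ji; rewrite -sumrN.
apply: eq_big => [j|j /andP[Jj /andP[_ ij]]].
  by rewrite Ji eq_sym.
rewrite wedge_sign_swap // mulNr scaleNr; congr (- (_ *: g _)).
  by rewrite (mulrC (v 0 j)).
by apply/setP => k; rewrite !inE andbCA.
Qed.

Lemma wedge_square g v : wedge (wedge g v) v = 0.
Proof.
have /eqP := wedge_anticomm g v v.
rewrite -addr_eq0 -mulr2n -scaler_nat => /eqP E; apply/eqP.
by move/eqP: E; rewrite scaler_eq0 pnatr_eq0.
Qed.

Lemma wedge_seq_front g s1 z s2 :
  wedges g (s1 ++ z :: s2) =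
    (-1) ^+ size s1 *: wedges (wedge g z) (s1 ++ s2).
Proof.
elim: s1 g => [|v s1 IHs] g /=; first by rewrite scale1r.
by rewrite IHs wedge_anticomm -[- wedge _ _]scaleN1r wedge_seqZ scalerA exprSr.
Qed.

Lemma wedge_seq_repeat g z s : z \in s -> wedges (wedge g z) s = 0.
Proof.
case/splitPr => s1 s2.
by rewrite wedge_seq_front wedge_square wedge_seq0 scaler0.
Qed.

(** * Vectors killed by a tensor *)

Lemma tensor_map_wedge g v w :
  tensor_map g w = 0 -> tensor_map (wedge g v) w = 0.
Proof.
move=> gw0; apply/ffunP => J; rewrite !ffunE mulmx_suml big1 // => j _.
by have /ffunP/(_ (J :\ j)%SET) := gw0; rewrite !ffunE -scalemxAl => ->;
   rewrite scaler0.
Qed.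

Lemma tensor_map_wedge_seq g s w :
  tensor_map g w = 0 -> tensor_at g s *m w = 0.
Proof.
move=> gw0; have {gw0} : tensor_map (wedges g s) w = 0.
  by elim: s g gw0 => //= v s IHs g /(tensor_map_wedge v)/IHs.
by move/ffunP/(_ [set: 'I_d.+1]%SET); rewrite !ffunE.
Qed.

(** * Hermitian tensors *)

(** Real coordinates are fixed by conjugation, so the coefficients of the
    product are real combinations of Hermitian matrices. *)
Lemma wedge_hermitian g v :
  hermitian_tensor g -> real_vec v -> hermitian_tensor (wedge g v).
Proof.
move=> hg hv J; apply/is_hermitianmxP; rewrite expr0 scale1r ffunE.
rewrite raddf_sum /= raddf_sum; apply: eq_bigr => j _ /=.
have /is_hermitianmxP := hg (J :\ j)%SET; rewrite expr0 scale1r => {1}->.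
rewrite linearZ /= map_mxZ rmorphM rmorphXn rmorphN rmorph1.
by move/CrealP: (hv j) => {1}<-.
Qed.

Lemma tensor_at_hermitian g s : hermitian_tensor g ->
  (forall v, v \in s -> real_vec v) -> tensor_at g s \is hermsymmx.
Proof.
rewrite /tensor_at => hg hs; suff: hermitian_tensor (wedges g s) by exact.
elim: s g hg hs => //= v s IHs g hg hs; apply: IHs.
  by apply: wedge_hermitian => //; apply: hs; rewrite mem_head.
by move=> x xs; apply: hs; rewrite inE xs orbT.
Qed.

Lemma quadratic_form_real (A : 'M[C]_n) w : A \is hermsymmx ->
  (w^t* *m A *m w) 0 0 \is Num.real.
Proof.
move=> /is_hermitianmxP; rewrite expr0 scale1r => hA.
apply/CrealP.
have -> : ((w^t* *m A *m w) 0 0)^*%R = (w^t* *m A *m w)^t* 0 0 by rewrite !mxE.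
by rewrite !trmx_mul !map_mxM trmxCK -hA mulmxA.
Qed.

(** * Coordinates of a point of the determinantal locus *)

Definition omit_nth (T : Type) (j : nat) (s : seq T) : seq T :=
  take j s ++ drop j.+1 s.

(** The head vector is isolated as the last argument so that the value of the
    tensor can be expanded linearly in it. *)
Definition tensor_at_cons g s z : 'M[C]_n := tensor_at (wedge g z) s.

Lemma tensor_at_cons_is_linear g s : linear (tensor_at_cons g s).
Proof.
move=> a u v; rewrite /tensor_at_cons /tensor_at wedge_is_linear.
by rewrite wedge_seq_linear !ffunE.
Qed.

HB.instance Definition _ g s :=
  GRing.isLinear.Build C vec 'M[C]_n _ (tensor_at_cons g s)
    (tensor_at_cons_is_linear g s).

Lemma mem_omit_nth r (v : r.-tuple vec) (i j : 'I_r) :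
  i != j -> v`_i \in omit_nth j v.
Proof.
have sv (l : 'I_r) : (l < size v)%N by rewrite size_tuple.
rewrite mem_cat; have [lt_ij|lt_ji|/val_inj ->] := ltngtP i j.
- by rewrite -(nth_take 0 lt_ij) mem_nth // size_takel // ltnW.
- rewrite -(subnKC lt_ji) -nth_drop mem_nth ?orbT //.
  by rewrite size_drop ltn_sub2r // (leq_ltn_trans lt_ji).
- by rewrite eqxx.
Qed.

(** The sign is the cost of moving the j-th vector to the front. *)
Lemma tensor_at_omit_nth g r (v : r.-tuple vec) (j : 'I_r) :
  tensor_at g v = (-1) ^+ j *: tensor_at_cons g (omit_nth j v) v`_j.
Proof.
have sj : (j < size v)%N by rewrite size_tuple.
rewrite /tensor_at_cons /tensor_at /omit_nth.
rewrite -{1}(cat_take_drop j v) (drop_nth 0 sj) wedge_seq_front ffunE.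
by rewrite size_takel // ltnW.
Qed.

(** Cramer's rule: wedging with all v_i but v_j turns every v_i with i distinct
    from j into 0, so of the point [a *: u + \sum_i c i *: v`_i] only the terms
    in u and v_j survive, and together they kill w. *)
Lemma kernel_coordinate g r (v : r.-tuple vec) u (a : C) (c : 'I_r -> C) w :
  tensor_map (wedge g (a *: u + \sum_i c i *: v`_i)) w = 0 ->
  forall j : 'I_r, c j *: (tensor_at g v *m w) =
    - a *: ((-1) ^+ j *: tensor_at_cons g (omit_nth j v) u *m w).
Proof.
move=> ker j.
have := tensor_map_wedge_seq (omit_nth j v) ker.
rewrite -/(tensor_at_cons _ _ _) linearD linearZ linear_sum (bigD1 j) //=.
rewrite [X in _ + (_ + X)]big1 ?addr0 => [|i ij]; last first.
  rewrite linearZ /= /tensor_at_cons /tensor_at.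
  by rewrite wedge_seq_repeat ?mem_omit_nth // ffunE scaler0.
rewrite (tensor_at_omit_nth g v j) linearZ /= mulmxDl -!scalemxAl.
move=> /eqP; rewrite addrC addr_eq0 => /eqP E.
by rewrite scalerA mulrC -scalerA E !scalerN !scaleNr !scalerA (mulrC a).
Qed.

(** Pairing the relation of [kernel_coordinate] with the conjugate transpose of
    w makes both matrices real numbers, by hermiticity, and the coefficient of
    c_j nonzero, by positivity.  The case a = 0 forces c = 0. *)
Lemma kernel_coordinate_real g r (v : r.-tuple vec) u (a : C) (c : 'I_r -> C)
    w :
  hermitian_tensor g -> (forall i : 'I_r, real_vec v`_i) -> real_vec u ->
  positive_definite (tensor_at g v) -> w != 0 ->
  tensor_map (wedge g (a *: u + \sum_i c i *: v`_i)) w = 0 ->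
  forall j, exists2 q, q \is Num.real & c j = a * q.
Proof.
move=> hg hv hu [_ pos] w0 ker j.
set s := omit_nth j v.
have vin x : x \in s -> real_vec x.
  move=> xs; have xv : x \in v.
    by move: xs; rewrite mem_cat => /orP[/mem_take|/mem_drop].
  move/(nthP 0): xv => [m]; rewrite size_tuple => mr <-.
  exact: hv (Ordinal mr).
pose p := (w^t* *m tensor_at g v *m w) 0 0.
pose q := (w^t* *m tensor_at_cons g s u *m w) 0 0.
have p_gt0 : 0 < p := pos w w0.
have q_real : q \is Num.real.
  apply: quadratic_form_real; apply: tensor_at_hermitian => //.
  exact: wedge_hermitian.
have E : c j * p = - a * ((-1) ^+ j * q).
  have /(congr1 (fun B => (w^t* *m B) 0 0)) := kernel_coordinate ker j.
  by rewrite -/s -scalemxAl -!scalemxAr !mulmxA /p /q !mxE.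
exists (- ((-1) ^+ j * q / p)).
  by rewrite rpredN rpred_div ?rpredM ?rpredX ?rpredN1 // gtr0_real.
have p_neq0 := lt0r_neq0 p_gt0; apply: (mulIf p_neq0).
by rewrite E mulrN !mulNr -!mulrA mulVf ?mulr1.
Qed.

End Wedge.

(** * Points and real subspaces *)

Section Points.
Variables (R : realType) (d n : nat).
Local Notation C := R[i].
Local Notation vec := 'rV[C]_d.+1.

Lemma hcoord_neq0 (x : proj_space R d) : hcoord x != 0.
Proof. by rewrite /hcoord vpick0 -dimv_eq0 (eqP (valP x)). Qed.

Lemma hcoord_span (x : proj_space R d) : val x = <[hcoord x]>%VS.
Proof.
apply/esym/eqP; rewrite eqEdim -memvE memv_pick /=.
by rewrite dim_vline hcoord_neq0 (eqP (valP x)).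
Qed.

Lemma real_point_span (x : proj_space R d) (u : vec) (a : C) :
  hcoord x = a *: u -> real_vec u -> real_point x.
Proof.
move=> xu hu; have := hcoord_neq0 x; rewrite xu scaler_eq0 => /norP[a0 u0].
exists [:: u]; last by move=> v; rewrite inE => /eqP ->.
rewrite basisEfree seq1_free u0 span_seq1 /= (eqP (valP x)) andbT.
rewrite hcoord_span xu -memvE; apply/vlineP; exists a^-1.
by rewrite scalerA mulVf ?scale1r.
Qed.

(** Taking a = 0 shows that no point of the locus lies in V, and for a point of
    the span of u and V the vector [a^-1 *: hcoord x] is real. *)
Lemma D_real_span (g : tensor R d n) (V : {vspace vec}) r (v : r.-tuple vec)
    (u y : vec) (a : C) (x : proj_space R d) :
  hermitian_tensor g -> basis_of V v ->
  (forall z, z \in tval v -> real_vec z) ->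
  positive_definite (tensor_at g v) -> real_vec u -> y \in V ->
  D g x -> hcoord x = a *: u + y -> a != 0 /\ real_point x.
Proof.
move=> hg vV v_real pos hu yV [w w0 ker] xE.
have hv (i : 'I_r) : real_vec v`_i.
  by apply/v_real/mem_nth; rewrite size_tuple.
rewrite (coord_basis vV yV) in xE; rewrite xE in ker.
have cE := kernel_coordinate_real hg hv hu pos w0 ker.
have a0 : a != 0.
  apply: contraNneq (hcoord_neq0 x) => a0.
  rewrite xE a0 scale0r add0r big1 // => i _.
  by have [q _ ->] := cE i; rewrite a0 mul0r scale0r.
split=> //.
apply: (@real_point_span x (u + \sum_i (coord v i y / a) *: v`_i) a).
  rewrite xE scalerDr scaler_sumr; congr (_ + _); apply: eq_bigr => i _.
  by rewrite scalerA mulrC divfK.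
move=> l; rewrite mxE rpredD ?hu // summxE rpred_sum // => i _.
have [q hq cq] := cE i.
by rewrite mxE cq (mulrC a) mulfK // rpredM // hv.
Qed.

Lemma line_complement (V U : {vspace vec}) (u : vec) :
  (V <= U)%VS -> \dim U = (\dim V).+1 -> u \in U -> u \notin V ->
  (U <= <[u]> + V)%VS.
Proof.
move=> VU dimU uU uV.
have uVU : (<[u]> + V <= U)%VS by rewrite subv_add -memvE uU.
rewrite -(geq_leqif (dimv_leqif_sup uVU)) dimU.
rewrite (ltn_leqif (dimv_leqif_sup (addvSr <[u]> V))).
by rewrite subv_add -memvE (negPf uV).
Qed.

(** A real basis of U cannot lie entirely in the smaller space V; any member
    of it outside V is a real complement. *)
Lemma real_subspace_ext (V U : {vspace vec}) :
  (V <= U)%VS -> \dim U = (\dim V).+1 -> real_subspace U ->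
  exists2 u, real_vec u & (U <= <[u]> + V)%VS.
Proof.
move=> VU dimU [b bU b_real].
have /allPn[u ub uV] : ~~ all [in V] b.
  apply/negP => /allP bV; have : (U <= V)%VS.
    by rewrite -(span_basis bU); apply/span_subvP.
  by move/dimvS; rewrite dimU ltnn.
exists u; first exact: b_real.
by apply: line_complement => //; rewrite -(span_basis bU) memv_span.
Qed.

End Points.

Theorem proposition3p12 (R : realType) (d k n : nat) (hk : (k <= d)%N)
    (X : set (proj_space R d))
    (hXreal : real_subvariety X) (hXdim : pure_dimension X k)
    (gamma : tensor R d n) (hgamma : tensor_of_degree k.+1 gamma)
    (hvr : very_reasonable k gamma) (hherm : hermitian_tensor gamma)
    (hXD : X = D gamma)
    (V : {vspace 'rV[R[i]]_d.+1})
    (hVreal : real_subspace V) (hVdim : \dim V = (d - k)%N)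
    (hVpos : exists v : (d - k).-tuple 'rV[R[i]]_d.+1,
       [/\ basis_of V v, (forall u, u \in tval v -> real_vec u)
         & positive_definite (tensor_at gamma v)]) :
  hyperbolic X V.
Proof.
rewrite hXD; case: hVpos => v [vV v_real pos].
have mem_hcoord (x : proj_space R d) (W : {vspace _}) :
    (val x <= W)%VS = (hcoord x \in W).
  by rewrite hcoord_span -memvE.
split=> [x Dx|U U_real dimU VU x Dx]; rewrite mem_hcoord => xW.
  have real0 : real_vec (0 : 'rV[R[i]]_d.+1) by move=> l; rewrite mxE rpred0.
  have xE : hcoord x = 0 *: 0 + hcoord x by rewrite scaler0 add0r.
  have [] := D_real_span hherm vV v_real pos real0 xW Dx xE.
  by rewrite eqxx.
have [u u_real /subvP UuV] := real_subspace_ext VU dimU U_real.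
have /memv_addP[_ /vlineP[a ->] [y yV xE]] := UuV _ xW.
by have [] := D_real_span hherm vV v_real pos u_real yV Dx xE.
Qed.
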